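(* Let $(\Omega,\mathcal{H},\hat{E})$ be a sublinear expectation space and let $\{Y_i\}_{i=1}^{\infty}$ be a sequence of $\mathbb{R}^d$-valued random variables in it satisfying the following conditions: (i) for every $i\ge1$, $Y_{i+1}$ is independent from $(Y_1,\ldots,Y_i)$; (ii) there exists a constant $M>0$ such that $\hat{E}[|Y_i|^2]\le M$ for all $i\ge1$; (v) there exists a bounded, convex and closed subset $\Gamma\subset\mathbb{R}^d$ such that $$\lim_{n\to\infty}\frac1n\sum_{i=1}^n d_H(\Gamma_i,\Gamma)=0,$$ where $\Gamma_i$ is a bounded, convex and closed subset of $\mathbb{R}^d$ such that $\hat{E}[\langle Y_i,p\rangle]=\sup_{q\in\Gamma_i}\langle q,p\rangle$ for all $p\in\mathbb{R}^d$. Let $S_n=Y_1+\cdots+Y_n$. Then $\{S_n/n\}_{n=1}^\infty$ converges in law to the maximal distribution $N(\Gamma;0)$, i.e. $$\lim_{n\to\infty}\hat{E}\left[\varphi\left(\frac{S_n}{n}\right)\right]=\hat{E}[\varphi(\eta)]\quad\text{for all }\varphi\in C_{b,Lip}(\mathbb{R}^d),$$ where $\eta\sim N(\Gamma;0)$.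
   Context: Sublinear expectation space: $\Omega$ is a set and $\mathcal{H}$ is a linear space of real functions on $\Omega$ containing the constants, closed under $X\mapsto|X|$, and such that $\varphi(X_1,\ldots,X_n)\in\mathcal{H}$ whenever $X_1,\ldots,X_n\in\mathcal{H}$ and $\varphi\in C_{l,Lip}(\mathbb{R}^n)$. Here $C_{l,Lip}(\mathbb{R}^n)$ is the space of $\varphi:\mathbb{R}^n\to\mathbb{R}$ with $|\varphi(x)-\varphi(y)|\le C(1+|x|^m+|y|^m)|x-y|$ for all $x,y$, for some $C>0$, $m\in\mathbb{N}$ depending on $\varphi$; $C_{b,Lip}(\mathbb{R}^n)$ is the space of bounded Lipschitz functions. A sublinear expectation is a functional $\hat{E}:\mathcal{H}\to\mathbb{R}$ that is monotone ($X\ge Y\Rightarrow\hat{E}[X]\ge\hat{E}[Y]$), constant preserving ($\hat{E}[c]=c$), sub-additive ($\hat{E}[X+Y]\le\hat{E}[X]+\hat{E}[Y]$) and positively homogeneous ($\hat{E}[\lambda X]=\lambda\hat{E}[X]$, $\lambda\ge0$). An $\mathbb{R}^d$-valued random variable is an element of $\mathcal{H}^d$. Independence: $Y\in\mathcal{H}^n$ is independent from $X\in\mathcal{H}^m$ if $\hat{E}[\varphi(X,Y)]=\hat{E}\big[\hat{E}[\varphi(x,Y)]|_{x=X}\big]$ for all $\varphi\in C_{l,Lip}(\mathbb{R}^{n+m})$. $d_H$ is the Hausdorff distance (for the Euclidean metric) on the set of nonempty bounded closed subsets of $\mathbb{R}^d$; the sets $\Gamma,\Gamma_i$ are nonempty.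 Maximal distribution: for a bounded, convex and closed $\Gamma\subset\mathbb{R}^d$, a $d$-dimensional random vector $\eta$ is maximal distributed, $\eta\sim N(\Gamma;0)$, if $\hat{E}[\varphi(\eta)]=\max_{y\in\Gamma}\varphi(y)$ for all $\varphi\in C_{b,Lip}(\mathbb{R}^d)$. The vector $\eta$ may live on another sublinear expectation space, whose expectation is still denoted $\hat{E}$. *)

(* Defs.v *)
From mathcomp Require Import all_boot all_order all_algebra.
From mathcomp Require Import all_classical all_reals all_analysis.

Set Implicit Arguments.
Unset Strict Implicit.
Unset Printing Implicit Defensive.

Import Order.TTheory GRing.Theory Num.Theory.
Import numFieldNormedType.Exports.

Local Open Scope classical_set_scope.
Local Open Scope ring_scope.

Section Euclidean.
Context {R : realType} {n : nat}.
Implicit Types (x y : 'rV[R]_n) (A B : set 'rV[R]_n).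

Definition dotp x y : R := \sum_(j < n) x 0 j * y 0 j.

(* [`|x|] on ['rV[R]_n] is the max norm, hence a separate Euclidean norm. The
   two are equivalent, so the library's [bounded_set] and [closed] on
   ['rV[R]_n] are the Euclidean notions. *)
Definition enorm x : R := Num.sqrt (dotp x x).

Definition dist_to_set A x : R := inf [set enorm (x - y) | y in A].

(* Meaningful for nonempty bounded sets: elsewhere the real-valued [sup] and
   [inf] may take their default value 0. *)
Definition hausdorff_dist A B : R :=
  Num.max (sup [set dist_to_set B x | x in A])
          (sup [set dist_to_set A y | y in B]).

Definition bounded_convex_closed A :=
  [/\ A !=set0, bounded_set A, convex_set A & closed A].

Definition C_l_Lip (phi : 'rV[R]_n -> R) :=
  exists (C : R) (m : nat), 0 < C /\ forall x y,
    `|phi x - phi y| <= C * (1 + enorm x ^+ m + enorm y ^+ m) * enorm (x - y).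

Definition C_b_Lip (phi : 'rV[R]_n -> R) :=
  bounded_fun phi /\
  exists L : R, forall x y, `|phi x - phi y| <= L * enorm (x - y).

End Euclidean.

(* The expectation is a functional on [sle_H]; it is represented by a total
   function on [sle_Omega -> R], about whose values outside [sle_H] nothing is
   assumed. *)
Record sublinear_expectation_space (R : realType) := SublinearExpectationSpace {
  sle_Omega : Type;
  sle_H : set (sle_Omega -> R);
  sle_E : (sle_Omega -> R) -> R;
  sle_H_add : forall X Y, sle_H X -> sle_H Y -> sle_H (fun w => X w + Y w);
  sle_H_scale : forall (a : R) X, sle_H X -> sle_H (fun w => a * X w);
  sle_H_cst : forall c : R, sle_H (fun=> c);
  sle_H_abs : forall X, sle_H X -> sle_H (fun w => `|X w|);
  sle_H_comp : forall n (phi : 'rV[R]_n -> R) (X : 'I_n -> sle_Omega -> R),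
    C_l_Lip phi -> (forall i, sle_H (X i)) ->
    sle_H (fun w => phi (\row_i X i w));
  sle_E_mono : forall X Y, sle_H X -> sle_H Y ->
    (forall w, Y w <= X w) -> sle_E Y <= sle_E X;
  sle_E_cst : forall c : R, sle_E (fun=> c) = c;
  sle_E_subadd : forall X Y, sle_H X -> sle_H Y ->
    sle_E (fun w => X w + Y w) <= sle_E X + sle_E Y;
  sle_E_poshom : forall (a : R) X, 0 <= a -> sle_H X ->
    sle_E (fun w => a * X w) = a * sle_E X }.

Section SublinearExpectation.
Context {R : realType}.
Implicit Types S T : sublinear_expectation_space R.

Definition random_vector S n (X : sle_Omega S -> 'rV[R]_n) :=
  forall j : 'I_n, sle_H (fun w => X w 0 j).

(* [indep_from Y X]: Y is independent from X, which is not symmetric. *)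
Definition indep_from S n m
    (Y : sle_Omega S -> 'rV[R]_n) (X : sle_Omega S -> 'rV[R]_m) :=
  forall phi : 'rV[R]_(m + n) -> R, C_l_Lip phi ->
    sle_E (fun w => phi (row_mx (X w) (Y w))) =
    sle_E (fun w => sle_E (fun w' => phi (row_mx (X w) (Y w')))).

(* The concatenation (Y_0, ..., Y_(k-1)) as a vector of R^(k * d). *)
Definition concat S d (Y : nat -> sle_Omega S -> 'rV[R]_d) (k : nat)
    (w : sle_Omega S) : 'rV[R]_(k * d) :=
  mxvec (\matrix_(i < k) Y i w).

Definition is_maximum (A : set R) (m : R) := A m /\ ubound A m.

Definition maximal_distributed T d (Gamma : set 'rV[R]_d)
    (eta : sle_Omega T -> 'rV[R]_d) :=
  random_vector eta /\
  forall phi : 'rV[R]_d -> R, C_b_Lip phi ->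
    is_maximum (phi @` Gamma) (sle_E (fun w => phi (eta w))).

Definition converges_in_law S T d (X : nat -> sle_Omega S -> 'rV[R]_d)
    (eta : sle_Omega T -> 'rV[R]_d) :=
  forall phi : 'rV[R]_d -> R, C_b_Lip phi ->
    (fun n => sle_E (fun w => phi (X n w))) @ \oo
      --> sle_E (fun w => phi (eta w)).

End SublinearExpectation.

(* Main.v *)
Require Import Defs.
From HB Require Import structures.
From mathcomp Require Import all_boot all_order all_algebra.
From mathcomp Require Import all_classical all_reals all_analysis.
From mathcomp Require Import ring lra.

Import Order.TTheory GRing.Theory Num.Theory.
Import numFieldNormedType.Exports.

Local Open Scope classical_set_scope.
Local Open Scope ring_scope.

(* A second-moment argument replaces the usual PDE. Let delta_k be the Hausdorff
   distance between Gamma_k and Gamma.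
   Upper bound: as in Blackwell's approachability theorem, conditioning on S_k
   and projecting it onto k Gamma gives
     E[dist(S_(k+1), (k+1) Gamma)^2]
       <= E[dist(S_k, k Gamma)^2] + 2 delta_k E[dist(S_k, k Gamma)] + C,
   and E[dist(S_k, k Gamma)] = O(k), so E[dist(S_n, n Gamma)^2] is
   O(n + n sum_k delta_k) = o(n^2); a Lipschitz phi then satisfies
   E[phi(S_n / n)] <= max_Gamma phi + o(1).
   Lower bound: for y in Gamma, E[<Y_k, p>] >= <y, p> - delta_k |p|, and the same
   recursion for E[- |S_k - k y|^2] gives E[- |S_n - n y|^2] >= - o(n^2); take for
   y a maximizer of phi. *)

(** * Euclidean geometry: Cauchy-Schwarz, distance to a set, Hausdorff distance, support functions,
    projection onto a convex set *)

Section EuclideanGeometry.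
Context {R : realType} {n : nat}.
Implicit Types (x y z s q : 'rV[R]_n) (A B G : set 'rV[R]_n).

Lemma dotpC x y : dotp x y = dotp y x.
Proof. by apply: eq_bigr => j _; rewrite mulrC. Qed.

Lemma dotpDl x y z : dotp (x + y) z = dotp x z + dotp y z.
Proof. by rewrite -big_split; apply: eq_bigr => j _; rewrite !mxE mulrDl. Qed.

Lemma dotpZl (a : R) x y : dotp (a *: x) y = a * dotp x y.
Proof. by rewrite mulr_sumr; apply: eq_bigr => j _; rewrite !mxE mulrA. Qed.

Lemma dotpNl x y : dotp (- x) y = - dotp x y.
Proof. by rewrite -scaleN1r dotpZl mulN1r. Qed.

Lemma dotpDr x y z : dotp x (y + z) = dotp x y + dotp x z.
Proof. by rewrite dotpC dotpDl !(dotpC _ x). Qed.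

Lemma dotpZr (a : R) x y : dotp x (a *: y) = a * dotp x y.
Proof. by rewrite dotpC dotpZl dotpC. Qed.

Lemma dotpNr x y : dotp x (- y) = - dotp x y.
Proof. by rewrite dotpC dotpNl dotpC. Qed.

Definition dotpE := (dotpDl, dotpDr, dotpNl, dotpNr, dotpZl, dotpZr).

Lemma dotp_ge0 x : 0 <= dotp x x.
Proof. by apply: sumr_ge0 => j _; rewrite -expr2 sqr_ge0. Qed.

Lemma enorm_ge0 x : 0 <= enorm x.
Proof. exact: sqrtr_ge0. Qed.

Lemma enorm_sqr x : enorm x ^+ 2 = dotp x x.
Proof. by rewrite sqr_sqrtr ?dotp_ge0. Qed.

Lemma enormZ (a : R) x : enorm (a *: x) = `|a| * enorm x.
Proof.
by rewrite /enorm !dotpE mulrA -expr2 sqrtrM ?sqr_ge0// sqrtr_sqr.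
Qed.

Lemma enorm0 : enorm (0 : 'rV[R]_n) = 0.
Proof. by rewrite -(scale0r 0) enormZ normr0 mul0r. Qed.

Lemma enormN x : enorm (- x) = enorm x.
Proof. by rewrite -scaleN1r enormZ normrN1 mul1r. Qed.

Lemma enormC x y : enorm (x - y) = enorm (y - x).
Proof. by rewrite -opprB enormN. Qed.

Lemma normr_coord_le_enorm x (j : 'I_n) : `|x 0 j| <= enorm x.
Proof.
rewrite -sqrtr_sqr ler_wsqrtr// /dotp (bigD1 j)//= -expr2 lerDl.
by apply: sumr_ge0 => i _; rewrite -expr2 sqr_ge0.
Qed.

Lemma enorm_eq0 x : enorm x = 0 -> x = 0.
Proof.
move=> x0; apply/rowP => j; rewrite mxE; apply/eqP; rewrite -normr_le0 -x0.
exact: normr_coord_le_enorm.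
Qed.

(** Cauchy-Schwarz: expand the nonnegative square of [|y| x - |x| y] and divide by [2 |x| |y|]. *)
Lemma dotp_le_enorm x y : dotp x y <= enorm x * enorm y.
Proof.
have [x0|x0] := eqVneq (enorm x) 0.
  by rewrite x0 mul0r (enorm_eq0 _ x0) -(scale0r 0) dotpZl mul0r.
have [y0|y0] := eqVneq (enorm y) 0.
  by rewrite y0 mulr0 (enorm_eq0 _ y0) -(scale0r 0) dotpZr mul0r.
have xy0 : 0 < enorm x * enorm y.
  by rewrite mulr_gt0// lt0r ?x0 ?y0 enorm_ge0.
have := dotp_ge0 (enorm y *: x - enorm x *: y).
rewrite !dotpE (dotpC y x) -!enorm_sqr => h.
have {}h : 0 <= 2 * (enorm x * enorm y) * (enorm x * enorm y - dotp x y) by nra.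
by move: h; rewrite pmulr_rge0 ?subr_ge0 // mulr_gt0.
Qed.

Lemma enorm_sqrD x y :
  enorm (x + y) ^+ 2 = enorm x ^+ 2 + 2 * dotp y x + enorm y ^+ 2.
Proof. by rewrite !enorm_sqr !dotpE (dotpC x y); ring. Qed.

Lemma enormD x y : enorm (x + y) <= enorm x + enorm y.
Proof.
rewrite -(@ler_pXn2r _ 2)// ?nnegrE ?addr_ge0 ?enorm_ge0//.
by rewrite enorm_sqrD dotpC; have := dotp_le_enorm x y; nra.
Qed.

Lemma enorm_dist x y : `|enorm x - enorm y| <= enorm (x - y).
Proof.
rewrite ler_norml; apply/andP; split.
  have := enormD (y - x) x; rewrite subrK enormC; lra.
have := enormD (x - y) y; rewrite subrK; lra.
Qed.

Lemma enorm_sqrB_le x y : enorm (x - y) ^+ 2 <= 2 * enorm x ^+ 2 + 2 * enorm y ^+ 2.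
Proof.
have := dotp_ge0 (x + y); rewrite !enorm_sqr !dotpE (dotpC y x); lra.
Qed.

Lemma enorm_sum_le (I : Type) (r : seq I) (F : I -> 'rV[R]_n) :
  enorm (\sum_(i <- r) F i) <= \sum_(i <- r) enorm (F i).
Proof.
elim: r => [|i r IH]; first by rewrite !big_nil enorm0.
by rewrite !big_cons (le_trans (enormD _ _))// lerD2l.
Qed.

(** This two-parameter form covers both the squared norm, maximized to bound a compact set, and the
    quadratic objective minimized by the projection. *)
Lemma continuous_dotp_sqr (a b : R) s :
  continuous (fun x => a * dotp x x + b * dotp s x).
Proof.
have sum_cont (F : 'I_n -> 'rV[R]_n -> R) : (forall j, continuous (F j)) ->
    continuous (fun x => \sum_j F j x).
  by move=> cF; apply: continuous_big => //; exact: add_continuous.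
have coord j : continuous (fun x => x 0 j : R) by exact: coord_continuous.
have sqr_cont : continuous (fun x => dotp x x).
  by apply: sum_cont => j y; exact: (cvgM (coord j y) (coord j y)).
have lin_cont : continuous (dotp s).
  by apply: sum_cont => j y; exact: (cvgM (cvg_cst (s 0 j)) (coord j y)).
move=> x.
exact: (cvgD (cvgM (cvg_cst a) (sqr_cont x)) (cvgM (cvg_cst b) (lin_cont x))).
Qed.

Lemma enorm_bounded {A} : bounded_convex_closed A ->
  exists2 B : R, 0 <= B & forall x, A x -> enorm x <= B.
Proof.
move=> [A0 bA _ cA].
have [|c _ cmax] := @EVT_max_rV _ _ (fun x => 1 * dotp x x + 0 * dotp 0 x) _ A0
  (bounded_closed_compact bA cA).
  exact/continuous_subspaceT/continuous_dotp_sqr.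
exists (enorm c) => [|x Ax]; first exact: enorm_ge0.
by have /cmax := mem_set Ax; rewrite !mul1r !mul0r !addr0 => /ler_wsqrtr.
Qed.

Lemma dist_to_set_ge {A} x (c : R) : A !=set0 ->
  (forall y, A y -> c <= enorm (x - y)) -> c <= dist_to_set A x.
Proof.
move=> A0 Ac; apply: lb_le_inf; first exact: image_nonempty.
by move=> _ [y Ay <-]; exact: Ac.
Qed.

Lemma dist_to_set_le {A} x y : A y -> dist_to_set A x <= enorm (x - y).
Proof.
move=> Ay; apply: ge_inf; last by exists y.
by exists 0 => _ [z _ <-]; exact: enorm_ge0.
Qed.

Lemma dist_to_set_ge0 A x : A !=set0 -> 0 <= dist_to_set A x.
Proof. by move=> A0; apply: dist_to_set_ge => // y _; exact: enorm_ge0. Qed.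

Lemma dist_to_set_lipschitz A x y : A !=set0 ->
  `|dist_to_set A x - dist_to_set A y| <= enorm (x - y).
Proof.
move=> A0; have half u v : dist_to_set A u - enorm (u - v) <= dist_to_set A v.
  apply: dist_to_set_ge => // z Az; have := dist_to_set_le u z Az.
  by have := enormD (u - v) (v - z); rewrite subrKA; lra.
by have := half x y; have := half y x; rewrite (enormC y x) ler_norml; lra.
Qed.

Lemma dist_to_set_approx {A} x (c : R) : A !=set0 -> dist_to_set A x < c ->
  exists2 y, A y & enorm (x - y) < c.
Proof.
by move=> A0 /(inf_lt (image_nonempty _ A0))[_ [y Ay <-] yc]; exists y.
Qed.

Lemma hausdorff_distC A B : hausdorff_dist A B = hausdorff_dist B A.
Proof. by rewrite /hausdorff_dist maxC. Qed.

Lemma dist_to_set_le_hausdorff A B x :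
  bounded_convex_closed A -> bounded_convex_closed B -> A x ->
  dist_to_set B x <= hausdorff_dist A B.
Proof.
move=> bA [[y By] _ _ _] Ax; rewrite /hausdorff_dist le_max; apply/orP; left.
have [C _ AC] := enorm_bounded bA.
(* Boundedness of [A] keeps the distances to [B] below [C + |y|], so this [sup] is a genuine
   supremum and not a default value. *)
apply: ub_le_sup; last by exists x.
exists (C + enorm y) => _ [z Az <-]; apply: le_trans (dist_to_set_le _ _ By) _.
by rewrite (le_trans (enormD _ _))// enormN lerD2r AC.
Qed.

Lemma hausdorff_dist_ge0 A B :
  bounded_convex_closed A -> bounded_convex_closed B -> 0 <= hausdorff_dist A B.
Proof.
move=> bA bB; have [[x Ax] _ _ _] := bA; have [B0 _ _ _] := bB.
exact: le_trans (dist_to_set_ge0 _ x B0) (dist_to_set_le_hausdorff _ _ _ bA bB Ax).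
Qed.

(** Replace [x] by a nearby point of [B]; Cauchy-Schwarz bounds the resulting change of the inner
    product. *)
Lemma dotp_le_hausdorff A B x p (c : R) :
  bounded_convex_closed A -> bounded_convex_closed B ->
  (forall y, B y -> dotp y p <= c) -> A x ->
  dotp x p <= c + hausdorff_dist A B * enorm p.
Proof.
move=> bA bB Bc Ax; have [B0 _ _ _] := bB.
have xB := dist_to_set_le_hausdorff _ _ _ bA bB Ax.
apply/ler_addgt0Pr => e e0.
(* The infimum is only approached, up to a slack [e / (|p| + 1)] that costs at most [e] after
   multiplication by [|p|]; the [+ 1] covers [p = 0]. *)
have p0 : 0 < enorm p + 1 by have := enorm_ge0 p; lra.
have [|y By xy] := dist_to_set_approx x
    (hausdorff_dist A B + e / (enorm p + 1)) B0.
  by rewrite (le_lt_trans xB)// ltrDl divr_gt0.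
have := dotp_le_enorm (x - y) p; rewrite dotpDl dotpNl => h.
have : enorm (x - y) * enorm p <=
    (hausdorff_dist A B + e / (enorm p + 1)) * enorm p.
  by rewrite ler_wpM2r ?enorm_ge0// ltW.
have : e / (enorm p + 1) * enorm p <= e.
  by rewrite mulrAC ler_pdivrMr// ler_pM2l//; lra.
by have := Bc _ By; nra.
Qed.

Lemma support_fun_le A p (c : R) : A !=set0 ->
  (forall y, A y -> dotp y p <= c) -> sup [set dotp y p | y in A] <= c.
Proof.
by move=> A0 Ac; apply: ge_sup; [exact: image_nonempty|move=> _ [y /Ac ? <-]].
Qed.

Lemma le_support_fun A p y : bounded_convex_closed A -> A y ->
  dotp y p <= sup [set dotp y p | y in A].
Proof.
move=> bA Ay; have [C _ AC] := enorm_bounded bA.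
apply: ub_le_sup; last by exists y.
exists (C * enorm p) => _ [z Az <-]; rewrite (le_trans (dotp_le_enorm _ _))//.
by rewrite ler_wpM2r ?enorm_ge0 ?AC.
Qed.

(* Minimizing [a |q|^2 - 2 <s, q>] rather than [|s - a q|^2], of which it is the
   nonconstant part divided by [a], also yields the variational inequality for
   [a = 0]. *)
Lemma projection_scaled G (a : R) s : bounded_convex_closed G -> 0 <= a ->
  exists p, [/\ G p, dist_to_set [set a *: q | q in G] s = enorm (s - a *: p) &
    forall q, G q -> dotp (q - p) (s - a *: p) <= 0].
Proof.
move=> [G0 bG cvG cG] a0.
have [|p /set_mem Gp pmin] := @EVT_min_rV _ _
  (fun x => a * dotp x x + (- 2) * dotp s x) _ G0 (bounded_closed_compact bG cG).
  exact/continuous_subspaceT/continuous_dotp_sqr.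
have {}pmin q : G q -> a * dotp p p - 2 * dotp s p <= a * dotp q q - 2 * dotp s q.
  by move=> /mem_set /pmin; lra.
exists p; split=> // [|q Gq].
  apply/eqP; rewrite eq_le dist_to_set_le /=; last by exists p.
  apply: dist_to_set_ge; first exact: image_nonempty.
  move=> _ [q Gq <-]; rewrite ler_wsqrtr// !dotpE !(dotpC _ s).
  by have := pmin _ Gq; nra.
(* First-order optimality: comparing [p] with [t q + (1 - t) p] gives [2 g <= t Q], and
   [t = e / (Q + e)] ensures [t Q <= e] with [0 < t <= 1]. *)
set g := dotp _ _; apply/ler_addgt0Pr => e e0.
pose Q := a * dotp (q - p) (q - p).
have Q0 : 0 <= Q by rewrite mulr_ge0 ?dotp_ge0.
pose t := e / (Q + e).
have Qe : 0 < Q + e by lra.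
have t0 : 0 < t by rewrite divr_gt0.
have t1 : t <= 1 by rewrite ler_pdivrMr//; lra.
have /pmin : G (t *: q + (1 - t) *: p).
  by have /set_mem := cvG _ _ (Itv01 (ltW t0) t1) (mem_set Gq) (mem_set Gp).
have tQ : t * Q <= e by rewrite mulrAC ler_pdivrMr// ler_pM2l//; lra.
move=> pm; have : 0 <= t * (t * Q - 2 * g).
  by move: pm; rewrite /Q /g !dotpE !(dotpC _ s) !(dotpC q p); lra.
by rewrite pmulr_rge0//; lra.
Qed.

End EuclideanGeometry.

(** * Functions whose local Lipschitz constant grows at most linearly *)

Section LinearGrowthModulus.
Context {R : realType} {n : nat}.
Implicit Types (f : 'rV[R]_n -> R).

(* [C_l_Lip] with [m = 1], which covers squares of Lipschitz functions. *)
Definition quad_lip f := exists2 C : R, 0 < C & forall x y,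
  `|f x - f y| <= C * (1 + enorm x + enorm y) * enorm (x - y).

Lemma quad_lip_C_l_Lip f : quad_lip f -> C_l_Lip f.
Proof. by move=> [C C0 fC]; exists C, 1%N; split. Qed.

Lemma quad_lipN f : quad_lip f -> quad_lip (fun x => - f x).
Proof. by move=> [C C0 fC]; exists C => // x y; rewrite -opprD normrN. Qed.

Lemma lipschitz_quad_lip {f} {L : R} :
  (forall x y, `|f x - f y| <= L * enorm (x - y)) -> quad_lip f.
Proof.
move=> fL; exists (`|L| + 1) => [|x y]; first by rewrite ltr_wpDl.
apply: (le_trans (fL x y)); rewrite ler_wpM2r ?enorm_ge0//.
have := enorm_ge0 x; have := enorm_ge0 y; have := ler_norm L.
by have := normr_ge0 L; nra.
Qed.

(** In [(f x - f y) (f x + f y)] the first factor is at most [|x - y|] and the second at most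
    [2 |f 0| + |x| + |y|], in absolute value. *)
Lemma lipschitz_sqr_quad_lip {f} :
  (forall x y, `|f x - f y| <= enorm (x - y)) -> quad_lip (fun x => f x ^+ 2).
Proof.
move=> f1; exists (2 * `|f 0| + 1) => [|x y]; first by rewrite ltr_wpDl ?mulr_ge0.
have f0 z : `|f z| <= `|f 0| + enorm z.
  have := f1 z 0; rewrite subr0 => h.
  by have := ler_normD (f z - f 0) (f 0); rewrite subrK; lra.
rewrite subr_sqr normrM mulrC ler_pM// (le_trans (ler_normD _ _))//.
have := f0 x; have := f0 y; have := enorm_ge0 x; have := enorm_ge0 y.
by have := normr_ge0 (f 0); nra.
Qed.

Lemma enorm_linear_le m (f : {linear 'rV[R]_m -> 'rV[R]_n}) :
  exists2 c : R, 0 <= c & forall z, enorm (f z) <= c * enorm z.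
Proof.
exists (\sum_(j < m) enorm (f (delta_mx 0 j))) => [|z].
  by apply: sumr_ge0 => j _; exact: enorm_ge0.
rewrite [in leLHS](row_sum_delta z) linear_sum (le_trans (enorm_sum_le _ _ _))//.
rewrite mulr_suml; apply: ler_sum => j _.
by rewrite linearZ enormZ mulrC ler_wpM2l ?enorm_ge0 ?normr_coord_le_enorm.
Qed.

End LinearGrowthModulus.

(** Makes a function of a sum of vectors an admissible test function of the concatenated vector, as
    independence requires. *)
Lemma quad_lip_comp_linear {R : realType} {m n : nat}
    (g : {linear 'rV[R]_m -> 'rV[R]_n}) (f : 'rV[R]_n -> R) :
  quad_lip f -> quad_lip (fun z => f (g z)).
Proof.
move=> [C C0 fC]; have [c c0 gc] := enorm_linear_le _ g.
exists (C * (c + 1) * (c + 1)) => [|x y]; first by rewrite !mulr_gt0 ?ltr_wpDl.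
apply: (le_trans (fC _ _)); rewrite -!mulrA ler_pM2l// -linearB.
rewrite [leRHS](_ : _ = ((c + 1) * (1 + enorm x + enorm y)) *
  ((c + 1) * enorm (x - y))); last by ring.
have := enorm_ge0 x; have := enorm_ge0 y; have := enorm_ge0 (x - y) => ? ? ?.
apply: ler_pM; rewrite ?addr_ge0 ?enorm_ge0//.
  by have := gc x; have := gc y; nra.
by have := gc (x - y); nra.
Qed.

(** * Comparison of sublinear expectations and membership in [sle_H] *)

Section SublinearExpectation.
Context {R : realType} (S : sublinear_expectation_space R).
Implicit Types (X Z W : sle_Omega S -> R).

(** Packs the four axioms of the expectation into the form used by the recursions below: a pointwise
    affine bound is integrated term by term. *)
Lemma sle_E_le_affine (b a : R) X W Z :
  sle_H X -> sle_H W -> sle_H Z -> 0 <= b ->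
  (forall w, Z w <= X w + b * W w + a) -> sle_E Z <= sle_E X + b * sle_E W + a.
Proof.
move=> HX HW HZ b0 ZX.
have HbW := sle_H_scale b HW; have HXW := sle_H_add HX HbW.
have Ha := sle_H_cst S a.
apply: le_trans (sle_E_mono (sle_H_add HXW Ha) HZ ZX) _.
apply: le_trans (sle_E_subadd HXW Ha) _; rewrite sle_E_cst lerD2r.
by apply: le_trans (sle_E_subadd HX HbW) _; rewrite sle_E_poshom.
Qed.

Lemma sle_H_quad_lip n (f : 'rV[R]_n -> R) (X : sle_Omega S -> 'rV[R]_n) :
  quad_lip f -> random_vector X -> sle_H (fun w => f (X w)).
Proof.
move=> /quad_lip_C_l_Lip /sle_H_comp fH /fH; congr sle_H; apply/funext => w.
by congr f; apply/rowP => j; rewrite mxE.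
Qed.

Lemma sle_H_enorm n (X : sle_Omega S -> 'rV[R]_n) :
  random_vector X -> sle_H (fun w => enorm (X w)).
Proof.
apply: sle_H_quad_lip; apply: (@lipschitz_quad_lip _ _ _ 1) => x y.
by rewrite mul1r enorm_dist.
Qed.

Lemma sle_H_enorm_sqr n (X : sle_Omega S -> 'rV[R]_n) :
  random_vector X -> sle_H (fun w => enorm (X w) ^+ 2).
Proof. exact: (sle_H_quad_lip _ _ X (lipschitz_sqr_quad_lip enorm_dist)). Qed.

Lemma sle_H_dotp n (X : sle_Omega S -> 'rV[R]_n) (p : 'rV[R]_n) :
  random_vector X -> sle_H (fun w => dotp (X w) p).
Proof.
apply: (sle_H_quad_lip _ (fun y => dotp y p)).
apply: (@lipschitz_quad_lip _ _ _ (enorm p)) => x y.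
rewrite -dotpNl -dotpDl mulrC ler_norml dotp_le_enorm andbT lerNl -dotpNl.
by rewrite -(enormN (x - y)) dotp_le_enorm.
Qed.

Lemma random_vector_cst n (x : 'rV[R]_n) : @random_vector R S n (fun=> x).
Proof. by move=> j; exact: sle_H_cst. Qed.

Lemma random_vectorD n (X X' : sle_Omega S -> 'rV[R]_n) :
  random_vector X -> random_vector X' -> random_vector (fun w => X w + X' w).
Proof.
move=> HX HX' j; have := sle_H_add (HX j) (HX' j).
by congr sle_H; apply/funext => w; rewrite mxE.
Qed.

Lemma random_vectorZ n (a : R) (X : sle_Omega S -> 'rV[R]_n) :
  random_vector X -> random_vector (fun w => a *: X w).
Proof.
move=> HX j; have := sle_H_scale a (HX j).
by congr sle_H; apply/funext => w; rewrite mxE.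
Qed.

Lemma random_vector_sum n (Y : nat -> sle_Omega S -> 'rV[R]_n) k :
  (forall i, random_vector (Y i)) -> random_vector (fun w => \sum_(i < k) Y i w).
Proof.
move=> HY; elim: k => [|k IH].
  have := random_vector_cst n 0; congr random_vector.
  by apply/funext => w; rewrite big_ord0.
have := random_vectorD _ _ _ IH (HY k); congr random_vector.
by apply/funext => w; rewrite big_ord_recr.
Qed.

(** Puts the inner expectation, evaluated at the past sum, in [sle_H], so that the outer one can be
    estimated. The growth due to [Y] integrates to the constant [e], and exchanging [s] and [s']
    makes the bound two-sided. *)
Lemma quad_lip_expect_shift n (f : 'rV[R]_n -> R) (Y : sle_Omega S -> 'rV[R]_n) :
  quad_lip f -> random_vector Y -> quad_lip (fun s => sle_E (fun w => f (s + Y w))).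
Proof.
move=> qf HY; have [C C0 fC] := qf.
have Hs s : sle_H (fun w => f (s + Y w)).
  exact: (sle_H_quad_lip _ _ _ qf (random_vectorD _ _ _ (random_vector_cst _ s) HY)).
have HE := sle_H_enorm _ _ HY.
set e := sle_E (fun w => enorm (Y w)).
have e0 : 0 <= e.
  rewrite -(sle_E_cst S 0); apply: (sle_E_mono HE (sle_H_cst _ _)) => w.
  exact: enorm_ge0.
have half s s' : sle_E (fun w => f (s + Y w)) <= sle_E (fun w => f (s' + Y w)) +
    (2 * C * enorm (s - s')) * e + C * (1 + enorm s + enorm s') * enorm (s - s').
  apply: sle_E_le_affine => // [|w]; first by rewrite !mulr_ge0 ?enorm_ge0// ltW.
  have := fC (s + Y w) (s' + Y w); rewrite opprD addrACA subrr addr0 => h.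
  have := ler_norm (f (s + Y w) - f (s' + Y w)).
  have : C * (1 + enorm (s + Y w) + enorm (s' + Y w)) * enorm (s - s') <=
      C * (1 + (enorm s + enorm (Y w)) + (enorm s' + enorm (Y w))) * enorm (s - s').
    by rewrite ler_wpM2r ?enorm_ge0// ler_pM2l// !lerD ?enormD.
  lra.
exists (C * (1 + 2 * e)) => [|x y]; first by rewrite mulr_gt0// ltr_wpDr// mulr_ge0.
have {}half s s' : sle_E (fun w => f (s + Y w)) - sle_E (fun w => f (s' + Y w)) <=
    C * (1 + 2 * e) * (1 + enorm s + enorm s') * enorm (s - s').
  have : 0 <= 2 * C * e * (enorm s + enorm s') * enorm (s - s').
    by rewrite !mulr_ge0 ?addr_ge0 ?enorm_ge0// ltW.
  by have := half s s'; lra.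
have := half x y; have := half y x; rewrite (enormC y x) ler_norml; lra.
Qed.

End SublinearExpectation.

(** * Conditioning a sum on its past through independence *)

Section IndependentSums.
Context {R : realType} (S : sublinear_expectation_space R) (d : nat)
  (Y : nat -> sle_Omega S -> 'rV[R]_d)
  (Y_indep : forall i, indep_from (Y i.+1) (concat Y i.+1)).

(** Recovers the sum of [k + 1] vectors from the flattened past joined to the last vector; linearity
    keeps the composed test function admissible. *)
Let total k (z : 'rV[R]_(k * d + d)) : 'rV[R]_d :=
  \sum_(i < k) row i (vec_mx (lsubmx z)) + rsubmx z.

Let total_is_linear k : linear (total k).
Proof.
move=> a u v; rewrite /total !linearP /=.
under eq_bigr do rewrite linearP.
by rewrite big_split -scaler_sumr /= scalerDr addrACA.
Qed.

Lemma sle_E_sum_recr k (f : 'rV[R]_d -> R) : quad_lip f ->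
  sle_E (fun w => f (\sum_(i < k.+1) Y i w)) =
  sle_E (fun w => sle_E (fun w' => f (\sum_(i < k) Y i w + Y k w'))).
Proof.
case: k => [|k] qf.
  (* Independence starts at [Y 1]. With an empty past sum the outer expectation is that of a
     constant. *)
  rewrite -[LHS](sle_E_cst S); congr sle_E; apply/funext => w.
  by congr sle_E; apply/funext => w'; rewrite big_ord_recr !big_ord0.
pose totalL : {linear 'rV[R]_(k.+1 * d + d) -> 'rV[R]_d} :=
  HB.pack (total k.+1) (GRing.isLinear.Build _ _ _ _ _ (total_is_linear k.+1)).
have totalE w y : total k.+1 (row_mx (concat Y k.+1 w) y) =
    \sum_(i < k.+1) Y i w + y.
  rewrite /total row_mxKl row_mxKr mxvecK; congr (_ + _).
  by apply: eq_bigr => i _; apply/rowP => j; rewrite !mxE.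
have := Y_indep k _ (quad_lip_C_l_Lip _ (quad_lip_comp_linear totalL _ qf)).
move=> indep; transitivity (sle_E (fun w =>
    f (totalL (row_mx (concat Y k.+1 w) (Y k.+1 w))))).
  by congr sle_E; apply/funext => w; rewrite /= totalE big_ord_recr.
by rewrite indep; congr sle_E; apply/funext => w; congr sle_E; apply/funext => w';
  rewrite /= totalE.
Qed.

End IndependentSums.

(** * Second-moment bounds for the partial sums relative to multiples of [Gamma] *)

Section ApproachingGamma.
Context {R : realType} {d : nat} (S : sublinear_expectation_space R)
  (Y : nat -> sle_Omega S -> 'rV[R]_d)
  (Y_rv : forall i, random_vector (Y i))
  (Y_indep : forall i, indep_from (Y i.+1) (concat Y i.+1))
  (M : R) (M_ge0 : 0 <= M)
  (Y_bound : forall i, sle_E (fun w => enorm (Y i w) ^+ 2) <= M)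
  (Gamma : set 'rV[R]_d) (Gamma_bcc : bounded_convex_closed Gamma)
  (Gamma_ : nat -> set 'rV[R]_d)
  (Gamma_i_bcc : forall i, bounded_convex_closed (Gamma_ i))
  (Gamma_support : forall i (p : 'rV[R]_d),
    sle_E (fun w => dotp (Y i w) p) = sup [set dotp q p | q in Gamma_ i])
  (G : R) (G_ge0 : 0 <= G) (Gamma_le : forall q, Gamma q -> enorm q <= G).

Let delta k := hausdorff_dist (Gamma_ k) Gamma.
Let total k w : 'rV[R]_d := \sum_(i < k) Y i w.
Let gap k s := dist_to_set [set k%:R *: q | q in Gamma] s.
(** Bounds the expectation of [|Y k - p|^2] for [p] in [Gamma], through
    [|a - b|^2 <= 2 |a|^2 + 2 |b|^2]. *)
Let step_cost := 2 * M + 2 * G ^+ 2.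
(** Bounds the expectation of [|Y k - p|] for [p] in [Gamma]: [1 + M] comes from [t <= t^2 + 1], and
    [G] from [|p|]. *)
Let mean_bound := 1 + M + G.

Let delta_ge0 k : 0 <= delta k.
Proof. exact: hausdorff_dist_ge0. Qed.

Let scaled_Gamma_neq0 k : [set k%:R *: q | q in Gamma] !=set0.
Proof. by case: Gamma_bcc => Gamma0 _ _ _; exact: image_nonempty. Qed.

Let gap_lipschitz k x y : `|gap k x - gap k y| <= enorm (x - y).
Proof. exact: dist_to_set_lipschitz. Qed.

Let shift_lipschitz (c x y : 'rV[R]_d) :
  `|enorm (x - c) - enorm (y - c)| <= enorm (x - y).
Proof. by rewrite (le_trans (enorm_dist _ _))// opprB addrA subrK. Qed.

Let total_rv k : random_vector (total k).
Proof. exact: random_vector_sum. Qed.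

(** Passing from the support function of [Gamma_ k] to that of [Gamma] costs at most
    [delta k * |p|]. *)
Let expect_dotp_le k p (c : R) : (forall q, Gamma q -> dotp q p <= c) ->
  sle_E (fun w => dotp (Y k w) p) <= c + delta k * enorm p.
Proof.
move=> Gc; rewrite Gamma_support; apply: support_fun_le => [|q Gq].
  by case: (Gamma_i_bcc k).
exact: dotp_le_hausdorff.
Qed.

Let expect_dotp_ge k p y : Gamma y ->
  dotp y p <= sle_E (fun w => dotp (Y k w) p) + delta k * enorm p.
Proof.
rewrite Gamma_support /delta hausdorff_distC => Gy.
by apply: dotp_le_hausdorff => // q; exact: le_support_fun.
Qed.

(* Blackwell's approachability argument: with [p] the point of [Gamma] such
   that [k p] is nearest to [s], the distance from [s + Y k] to [(k + 1) Gamma]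
   is at most [|(s - k p) + (Y k - p)|], and the cross term
   [<s - k p, Y k - p>] has expectation at most [delta k * |s - k p|]. *)
Let expect_gap_sqr_shift k s :
  sle_E (fun w => gap k.+1 (s + Y k w) ^+ 2) <=
  gap k s ^+ 2 + 2 * delta k * gap k s + step_cost.
Proof.
have [p [Gp gapE pmax]] := projection_scaled _ k%:R s Gamma_bcc (ler0n _ _).
rewrite /gap gapE; set r := s - k%:R *: p.
(* The expanded square is split into a part linear in [Y k], a part controlled by [M], and a
   constant. *)
have step w : gap k.+1 (s + Y k w) ^+ 2 <= dotp (Y k w) (2 *: r) +
    2 * enorm (Y k w) ^+ 2 + (enorm r ^+ 2 - 2 * dotp p r + 2 * G ^+ 2).
  have : gap k.+1 (s + Y k w) <= enorm (r + (Y k w - p)).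
    rewrite (_ : r + _ = s + Y k w - k.+1%:R *: p); first last.
      by rewrite -natr1 scalerDl scale1r opprD addrACA addrA.
    by apply: dist_to_set_le; exists p.
  rewrite -(@ler_pXn2r _ 2)// ?nnegrE ?enorm_ge0 ?dist_to_set_ge0// => /le_trans.
  apply; have := enorm_sqrB_le (Y k w) p.
  have : enorm p ^+ 2 <= G ^+ 2 by rewrite ler_pXn2r ?nnegrE ?enorm_ge0 ?Gamma_le.
  by rewrite (enorm_sqrD r) dotpDl dotpNl dotpZr; lra.
have HY2 := sle_H_enorm_sqr _ _ _ (Y_rv k).
have HYr := sle_H_dotp _ _ _ (2 *: r) (Y_rv k).
have Hgap := sle_H_quad_lip _ _ _ _ (lipschitz_sqr_quad_lip (gap_lipschitz k.+1))
  (random_vectorD _ _ _ _ (random_vector_cst _ _ s) (Y_rv k)).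
apply: le_trans (sle_E_le_affine _ 2 _ _ _ _ HYr HY2 Hgap (ler0n _ _) step) _.
have : sle_E (fun w => dotp (Y k w) (2 *: r)) <=
    2 * dotp p r + delta k * enorm (2 *: r).
  apply: expect_dotp_le => q /pmax.
  by rewrite -/r dotpZr dotpDl dotpNl; lra.
rewrite enormZ ger0_norm// /step_cost; have := Y_bound k; lra.
Qed.

(** Subadditivity bounds the expectation of a sum only from above. The linear term of the expanded
    square, whose expectation is bounded below, is therefore isolated on the smaller side. *)
Let expect_enorm_sqr_shift k s y : Gamma y ->
  - enorm (s - k%:R *: y) ^+ 2 <=
  sle_E (fun w => - enorm (s + Y k w - k.+1%:R *: y) ^+ 2) +
  2 * delta k * enorm (s - k%:R *: y) + step_cost.
Proof.
move=> Gy; set r := s - k%:R *: y.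
pose next w := - enorm (s + Y k w - k.+1%:R *: y) ^+ 2.
have step w : dotp (Y k w) (- 2 *: r) <= next w +
    2 * enorm (Y k w) ^+ 2 + (enorm r ^+ 2 - 2 * dotp y r + 2 * G ^+ 2).
  rewrite /next (_ : s + Y k w - _ = r + (Y k w - y)); first last.
    by rewrite -natr1 scalerDl scale1r opprD addrACA addrA.
  have := enorm_sqrB_le (Y k w) y.
  have : enorm y ^+ 2 <= G ^+ 2 by rewrite ler_pXn2r ?nnegrE ?enorm_ge0 ?Gamma_le.
  by rewrite (enorm_sqrD r) dotpDl dotpNl dotpZr; lra.
have HY2 := sle_H_enorm_sqr _ _ _ (Y_rv k).
have HYr := sle_H_dotp _ _ _ (- 2 *: r) (Y_rv k).
have Hnext : sle_H next.
  exact: (sle_H_quad_lip _ _ _ _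
    (quad_lipN _ (lipschitz_sqr_quad_lip (shift_lipschitz (k.+1%:R *: y))))
    (random_vectorD _ _ _ _ (random_vector_cst _ _ s) (Y_rv k))).
have := sle_E_le_affine _ 2 _ _ _ _ Hnext HY2 HYr (ler0n _ _) step.
have := expect_dotp_ge k (- 2 *: r) y Gy.
rewrite enormZ normrN ger0_norm// dotpZr /step_cost; have := Y_bound k; lra.
Qed.

Let expect_enorm_total k : sle_E (fun w => enorm (total k w)) <= k%:R * (1 + M).
Proof.
elim: k => [|k IH].
  rewrite mul0r -[leRHS](sle_E_cst S) le_eqVlt; apply/orP; left; apply/eqP.
  by congr sle_E; apply/funext => w; rewrite /total big_ord0 enorm0.
have HY2 := sle_H_enorm_sqr _ _ _ (Y_rv k).
have HS := sle_H_enorm _ _ _ (total_rv k).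
have HS1 := sle_H_enorm _ _ _ (total_rv k.+1).
have step w : enorm (total k.+1 w) <= enorm (total k w) + 1 * enorm (Y k w) ^+ 2 + 1.
  rewrite /total big_ord_recr/=.
  have := enormD (\sum_(i < k) Y i w) (Y k w).
  by have := sqr_ge0 (enorm (Y k w) - 1); have := enorm_ge0 (Y k w); nra.
apply: le_trans (sle_E_le_affine _ 1 _ _ _ _ HS HY2 HS1 ler01 step) _.
by have := Y_bound k; rewrite -natr1; lra.
Qed.

Let expect_enorm_centered k y : Gamma y ->
  sle_E (fun w => enorm (total k w - k%:R *: y)) <= k%:R * mean_bound.
Proof.
move=> Gy; have HS := sle_H_enorm _ _ _ (total_rv k).
have HSy := sle_H_enorm _ _ _
  (random_vectorD _ _ _ _ (total_rv k) (random_vector_cst _ _ (- (k%:R *: y)))).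
have step w : enorm (total k w - k%:R *: y) <=
    enorm (total k w) + 0 * enorm (total k w) + k%:R * G.
  rewrite (le_trans (enormD _ _))// mul0r addr0 lerD2l enormN enormZ ger0_norm//.
  by rewrite ler_wpM2l// Gamma_le.
apply: le_trans (sle_E_le_affine _ 0 _ _ _ _ HS HS HSy (lexx 0) step) _.
by have := expect_enorm_total k; rewrite /mean_bound; lra.
Qed.

Let expect_gap k : sle_E (fun w => gap k (total k w)) <= k%:R * mean_bound.
Proof.
have [[y Gy] _ _ _] := Gamma_bcc.
have Hgap : sle_H (fun w => gap k (total k w)).
  apply: sle_H_quad_lip => //; apply: (@lipschitz_quad_lip _ _ _ 1) => u v.
  by rewrite mul1r.
have HSy := sle_H_enorm _ _ _
  (random_vectorD _ _ _ _ (total_rv k) (random_vector_cst _ _ (- (k%:R *: y)))).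
apply: le_trans (expect_enorm_centered k y Gy); apply: sle_E_mono => // w.
by apply: dist_to_set_le; exists y.
Qed.

(** Accumulates the one-step increments, with the expected distance at time [k] replaced by its
    bound [k * mean_bound]. *)
Let cost n := \sum_(k < n) (2 * delta k * (k%:R * mean_bound) + step_cost).

Let expect_gap_sqr n : sle_E (fun w => gap n (total n w) ^+ 2) <= cost n.
Proof.
have gap2 k := lipschitz_sqr_quad_lip (gap_lipschitz k).
elim: n => [|n IH].
  (* At time 0 the scaled set is [{0}] because [Gamma] is nonempty, and the empty sum lies in it. *)
  rewrite /cost big_ord0 -[leRHS](sle_E_cst S) le_eqVlt; apply/orP; left; apply/eqP.
  congr sle_E; apply/funext => w; apply/eqP; rewrite sqrf_eq0 eq_le.
  rewrite dist_to_set_ge0// andbT; have [[y Gy] _ _ _] := Gamma_bcc.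
  rewrite -[leRHS](enorm0 (R := R) (n := d)) /gap /total big_ord0.
  by rewrite -[X in enorm X](subrr 0) -{3}(scale0r y) dist_to_set_le//; exists y.
rewrite (sle_E_sum_recr _ _ _ Y_indep n (fun s => gap n.+1 s ^+ 2))//.
have Hgap2 := sle_H_quad_lip _ _ _ _ (gap2 n) (total_rv n).
have Hgap : sle_H (fun w => gap n (total n w)).
  apply: sle_H_quad_lip => //; apply: (@lipschitz_quad_lip _ _ _ 1) => u v.
  by rewrite mul1r.
have HF := sle_H_quad_lip _ _ _ _ (quad_lip_expect_shift _ _ _ _ (gap2 n.+1) (Y_rv n))
  (total_rv n).
have d0 : 0 <= 2 * delta n by rewrite mulr_ge0.
apply: le_trans (sle_E_le_affine _ _ _ _ _ _ Hgap2 Hgap HF d0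
  (fun w => expect_gap_sqr_shift n (total n w))) _.
rewrite /cost big_ord_recr/=.
have := ler_wpM2l d0 (expect_gap n); rewrite -/(cost n); lra.
Qed.

(** Iterates the lower one-step estimate. The increments are the same as for the distance, since
    [|S_k - k y|] has the same bound in expectation. *)
Let expect_enorm_sqr_centered n y : Gamma y ->
  - cost n <= sle_E (fun w => - enorm (total n w - n%:R *: y) ^+ 2).
Proof.
move=> Gy.
have qlip k := quad_lipN _ (lipschitz_sqr_quad_lip (shift_lipschitz (k%:R *: y))).
elim: n => [|n IH].
  rewrite /cost big_ord0 oppr0 -[leLHS](sle_E_cst S) le_eqVlt; apply/orP; left.
  apply/eqP; congr sle_E; apply/funext => w.
  by rewrite /total big_ord0 scale0r subr0 enorm0 expr0n oppr0.
rewrite (sle_E_sum_recr _ _ _ Y_indep n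
  (fun s => - enorm (s - n.+1%:R *: y) ^+ 2))//.
have HS2 := sle_H_quad_lip _ _ _ _ (qlip n) (total_rv n).
have HS := sle_H_enorm _ _ _
  (random_vectorD _ _ _ _ (total_rv n) (random_vector_cst _ _ (- (n%:R *: y)))).
have HF := sle_H_quad_lip _ _ _ _ (quad_lip_expect_shift _ _ _ _ (qlip n.+1) (Y_rv n))
  (total_rv n).
have d0 : 0 <= 2 * delta n by rewrite mulr_ge0.
have := sle_E_le_affine _ _ _ _ _ _ HF HS HS2 d0
  (fun w => expect_enorm_sqr_shift n (total n w) y Gy).
rewrite /cost big_ord_recr/=.
have := ler_wpM2l d0 (expect_enorm_centered n y Gy); rewrite -/(cost n); lra.
Qed.

(** Upper bound for [cost n / n^2]: a multiple of the averaged Hausdorff distances plus a term of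
    order [1 / n]. *)
Definition mean_cost (n : nat) : R :=
  2 * mean_bound * (n%:R^-1 * \sum_(k < n) delta k) + step_cost * n%:R^-1.

Let cost_le n : (0 < n)%N -> n%:R^-1 ^+ 2 * cost n <= mean_cost n.
Proof.
move=> n0; have n0R : n%:R != 0 :> R by rewrite pnatr_eq0 -lt0n.
have mb0 : 0 <= mean_bound by rewrite !addr_ge0.
have : cost n <= n%:R * (2 * mean_bound * (\sum_(k < n) delta k) + step_cost).
  rewrite /cost big_split/= sumr_const card_ord.
  rewrite -[step_cost *+ n]mulr_natl [leRHS]mulrDr lerD2r.
  rewrite !mulr_sumr; apply: ler_sum => k _.
  have -> : 2 * delta k * (k%:R * mean_bound) = k%:R * (2 * mean_bound * delta k).
    by ring.
  (* Bounding [k] by [n] in each summand takes a factor [n] out of the sum. *)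
  by rewrite ler_wpM2r ?mulr_ge0// ler_nat ltnW.
rewrite -(@ler_pM2l _ (n%:R^-1 ^+ 2)) ?exprn_gt0 ?invr_gt0 ?ltr0n// => /le_trans.
by apply; rewrite le_eqVlt /mean_cost; apply/orP; left; apply/eqP; field.
Qed.

Lemma expect_gap_sqr_mean n : (0 < n)%N ->
  n%:R^-1 ^+ 2 * sle_E (fun w =>
    dist_to_set [set n%:R *: q | q in Gamma] (\sum_(i < n) Y i w) ^+ 2) <=
  mean_cost n.
Proof.
move=> n0; apply: le_trans (cost_le n n0).
by rewrite ler_wpM2l ?exprn_ge0 ?invr_ge0// expect_gap_sqr.
Qed.

Lemma expect_enorm_sqr_mean n y : (0 < n)%N -> Gamma y ->
  - mean_cost n <= n%:R^-1 ^+ 2 *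
    sle_E (fun w => - enorm (\sum_(i < n) Y i w - n%:R *: y) ^+ 2).
Proof.
move=> n0 Gy; rewrite lerNl -mulrN; apply: le_trans (cost_le n n0).
by rewrite ler_wpM2l ?exprn_ge0 ?invr_ge0// lerNl expect_enorm_sqr_centered.
Qed.

Lemma mean_cost_cvg :
  (fun n : nat => n%:R^-1 * \sum_(k < n) hausdorff_dist (Gamma_ k) Gamma)
    @ \oo --> (0 : R) -> mean_cost @ \oo --> (0 : R).
Proof.
move=> delta_cvg.
have inv_cvg : (fun n : nat => n%:R^-1 : R) @ \oo --> (0 : R).
  apply/gtr0_cvgV0; last exact: cvgr_idn.
  by near=> n; rewrite ltr0n; near: n; exact: nbhs_infty_gt.
have := cvgD (cvgM (cvg_cst (2 * mean_bound)) delta_cvg)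
  (cvgM (cvg_cst step_cost) inv_cvg).
by rewrite !mulr0 addr0; apply.
Unshelve. all: by end_near. Qed.

(* [t <= e + t^2 / e] trades the linear modulus of [phi] for the second moments
   above. *)
Let le_add_sqr_div (t e : R) : 0 <= t -> 0 < e -> t <= e + e^-1 * t ^+ 2.
Proof.
move=> t0 e0; rewrite -(ler_pM2l e0) mulrDr mulVKf ?gt_eqF//; nra.
Qed.

Lemma expect_mean_near_max (phi : 'rV[R]_d -> R) (L : R) y e n :
  (forall u v, `|phi u - phi v| <= L * enorm (u - v)) -> 0 < L ->
  Gamma y -> (forall q, Gamma q -> phi q <= phi y) -> 0 < e -> (0 < n)%N ->
  `|phi y - sle_E (fun w => phi (n%:R^-1 *: \sum_(i < n) Y i w))| <=
  L * e + L / e * mean_cost n.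
Proof.
move=> phiL L0 Gy ymax e0 n0.
have n0R : n%:R != 0 :> R by rewrite pnatr_eq0 -lt0n.
have Le0 : 0 < L / e by rewrite divr_gt0.
have b0 : 0 <= L / e * n%:R^-1 ^+ 2 by rewrite mulr_ge0 ?exprn_ge0 ?invr_ge0// ltW.
(* The linear-to-quadratic trade is applied with [t = s / n], where [s] is a distance before
   division by [n]. *)
have phi_le s u v : enorm (u - v) = n%:R^-1 * s -> 0 <= s ->
    phi u <= phi v + L * e + L / e * n%:R^-1 ^+ 2 * s ^+ 2.
  move=> uv s0; have := phiL u v; rewrite uv => h.
  have ns0 : 0 <= n%:R^-1 * s by rewrite mulr_ge0 ?invr_ge0.
  have := ler_wpM2l (ltW L0) (le_add_sqr_div _ _ ns0 e0).
  by have := ler_norm (phi u - phi v); rewrite exprMn; lra.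
have scaleE s (q : 'rV[R]_d) :
    enorm (n%:R^-1 *: s - q) = n%:R^-1 * enorm (s - n%:R *: q).
  have -> : n%:R^-1 *: s - q = n%:R^-1 *: (s - n%:R *: q).
    by rewrite scalerBr scalerA mulVf// scale1r.
  by rewrite enormZ ger0_norm ?invr_ge0.
have Hphi : sle_H (fun w => phi (n%:R^-1 *: total n w)).
  exact: (sle_H_quad_lip _ _ _ _ (lipschitz_quad_lip phiL)
    (random_vectorZ _ _ _ _ (total_rv n))).
have H0 := sle_H_cst S 0.
rewrite ler_norml; apply/andP; split.
  (* Upper bound on the expectation: compare [S_n / n] with the point [p] of [Gamma] such that [n p]
     is nearest to [S_n], where [phi p <= phi y]. *)
  have Hgap2 := sle_H_quad_lip _ _ _ _
    (lipschitz_sqr_quad_lip (gap_lipschitz n)) (total_rv n).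
  have step w : phi (n%:R^-1 *: total n w) <=
      0 + (L / e * n%:R^-1 ^+ 2) * gap n (total n w) ^+ 2 + (phi y + L * e).
    have [p [Gp gapE _]] :=
      projection_scaled _ n%:R (total n w) Gamma_bcc (ler0n _ _).
    rewrite /gap gapE.
    have := phi_le _ _ _ (scaleE (total n w) p) (enorm_ge0 _).
    by have := ymax _ Gp; lra.
  have := sle_E_le_affine _ _ _ _ _ _ H0 Hgap2 Hphi b0 step.
  rewrite sle_E_cst -mulrA.
  by have := ler_wpM2l (ltW Le0) (expect_gap_sqr_mean n n0); rewrite -/(total _ _); lra.
(* Lower bound: compare [S_n / n] with the fixed maximizer [y]. The negative square stays inside the
   expectation, which does not commute with negation. *)
pose N w := - enorm (total n w - n%:R *: y) ^+ 2.
have HN : sle_H N.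
  exact: (sle_H_quad_lip _ _ _ _
    (quad_lipN _ (lipschitz_sqr_quad_lip (shift_lipschitz (n%:R *: y)))) (total_rv n)).
have HbN := sle_H_scale (L / e * n%:R^-1 ^+ 2) HN.
have step w : L / e * n%:R^-1 ^+ 2 * N w <=
    phi (n%:R^-1 *: total n w) + 0 * 0 + (L * e - phi y).
  have yE : enorm (y - n%:R^-1 *: total n w) = n%:R^-1 * enorm (total n w - n%:R *: y).
    by rewrite enormC scaleE.
  by have := phi_le _ _ _ yE (enorm_ge0 _); rewrite /N; lra.
have := sle_E_le_affine _ 0 _ _ _ _ Hphi H0 HbN (lexx 0) step.
rewrite sle_E_poshom// -mulrA.
by have := ler_wpM2l (ltW Le0) (expect_enorm_sqr_mean n y n0 Gy); lra.
Qed.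

End ApproachingGamma.

(* Indices start at 0: [Y i] and [Gamma_ i] stand for Y_(i+1) and Gamma_(i+1). *)
Theorem corollary5p6 (R : realType) (d : nat)
  (S : sublinear_expectation_space R)
  (Y : nat -> sle_Omega S -> 'rV[R]_d)
  (Y_rv : forall i, random_vector (Y i))
  (Y_indep : forall i, indep_from (Y i.+1) (concat Y i.+1))
  (M : R) (M_gt0 : 0 < M)
  (Y_bound : forall i, sle_E (fun w => enorm (Y i w) ^+ 2) <= M)
  (Gamma : set 'rV[R]_d) (Gamma_bcc : bounded_convex_closed Gamma)
  (Gamma_ : nat -> set 'rV[R]_d)
  (Gamma_i_bcc : forall i, bounded_convex_closed (Gamma_ i))
  (Gamma_support : forall i (p : 'rV[R]_d),
    sle_E (fun w => dotp (Y i w) p) = sup [set dotp q p | q in Gamma_ i])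
  (Gamma_cvg : (fun n : nat =>
      n%:R^-1 * \sum_(i < n) hausdorff_dist (Gamma_ i) Gamma) @ \oo --> (0 : R))
  (T : sublinear_expectation_space R) (eta : sle_Omega T -> 'rV[R]_d)
  (eta_max : maximal_distributed Gamma eta) :
  converges_in_law (fun n w => n%:R^-1 *: \sum_(i < n) Y i w) eta.
Proof.
(* The maximal distribution turns the limit into [phi y] for a maximizer [y] of [phi] on [Gamma]. *)
move=> phi phi_bl; have [_ /(_ _ phi_bl)[[y Gy <-] ymax]] := eta_max.
have {}ymax q : Gamma q -> phi q <= phi y by move=> Gq; apply: ymax; exists q.
have [_ [L0 phiL0]] := phi_bl; pose L := `|L0| + 1.
have L_gt0 : 0 < L by rewrite ltr_wpDl.
have phiL u v : `|phi u - phi v| <= L * enorm (u - v).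
  rewrite (le_trans (phiL0 u v))// ler_wpM2r ?enorm_ge0//.
  by rewrite /L; have := ler_norm L0; lra.
have [G G_ge0 Gamma_le] := enorm_bounded Gamma_bcc.
apply/cvgrPdist_le => eps eps0.
(* Half of [eps] goes to [L * e]; once [mean_cost] is at most [e^2 / 2], the other term is at most
   [L * e / 2 = eps / 4]. *)
have [e e0 Le] : exists2 e : R, 0 < e & L * e = eps / 2.
  exists (eps / (2 * L)); first by rewrite divr_gt0 ?mulr_gt0.
  by field; rewrite gt_eqF.
have := mean_cost_cvg M Gamma Gamma_ G Gamma_cvg.
move=> /cvgrPdist_le/(_ (e * e / 2)) cost_small.
near=> n.
have n0 : (0 < n)%N by near: n; exact: nbhs_infty_gt.
have := expect_mean_near_max S Y Y_rv Y_indep M (ltW M_gt0) Y_bound Gamma Gamma_bcc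
  Gamma_ Gamma_i_bcc Gamma_support G G_ge0 Gamma_le phi L y e n
  phiL L_gt0 Gy ymax e0 n0.
move=> /le_trans; apply; rewrite Le.
have : mean_cost M Gamma Gamma_ G n <= e * e / 2.
  have : `|0 - mean_cost M Gamma Gamma_ G n| <= e * e / 2.
    by near: n; apply: cost_small; apply: divr_gt0 => //; exact: mulr_gt0.
  by rewrite sub0r normrN; apply: le_trans; exact: ler_norm.
rewrite -(@ler_pM2l _ (L / e)) ?divr_gt0//.
have -> : L / e * (e * e / 2) = L * e / 2 by field; exact: lt0r_neq0.
rewrite Le; lra.
Unshelve. all: by end_near. Qed.
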